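(* Let $q$ be a prime power, let $m\ge1$ and $t$ be integers with $t+1\mid m$, let $H(x)\in\mathbb F_q[x]$ be a monic irreducible polynomial of degree $t+1$, and let $\alpha\in\mathbb F_{q^{t+1}}^*$ be a root of $H(x)$, so that $H(x)=\prod_{i=0}^t(x-\alpha^{q^i})$. Write $\alpha_i=\alpha^{q^{i-1}}$ for $1\le i\le t+1$, and let $L\subseteq\mathbb F_{q^m}$ be a set with $\alpha_1,\ldots,\alpha_{t+1}\in L$. Let $V_1(x)=\lambda_1x^{\mu_1}$ and $V_2(x)=\lambda_2x^{\mu_2}+\lambda_3$, where $\lambda_1,\lambda_2,\lambda_3\in\mathbb F_{q^m}^*$ and $\mu_1,\mu_2>0$ are integers, and set $$V(x)=V_1(x)V_2(x)=\lambda_1x^{\mu_1}\left(\lambda_2x^{\mu_2}+\lambda_3\right).$$ Let $G(x)$ be the unique remainder of $V(x)H'(x)$ modulo $H(x)$, and assume that $G(\eta)\ne0$ for every $\eta\in L$. Let $N_\alpha=\operatorname{ord}(\alpha)$ be the multiplicative order of $\alpha$. Suppose that $$\lambda_1\lambda_2\operatorname{Tr}_{\mathbb F_{q^{t+1}}/\mathbb F_q}(\alpha^{\mu_1+\mu_2})+\lambda_1\lambda_3\operatorname{Tr}_{\mathbb F_{q^{t+1}}/\mathbb F_q}(\alpha^{\mu_1})\ne0,$$ $$\frac{N_\alpha}{\gcd(N_\alpha,(q-1)^2)}\ \Big|\ \mu_1,\qquad\frac{N_\alpha}{\gcd(N_\alpha,(q-1)^2)}\ \Big|\ \mu_2,$$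 $$1+\frac{\lambda_3}{\lambda_2\alpha^{\mu_2q^t}}\in\mathbb F_q^*,$$ and $$\lambda_3\ne-\lambda_2\alpha^{\mu_2q^{i-1}},\qquad1\le i\le t.$$ Then the $q$-ary Goppa code $\Gamma(L,G)$ has minimum distance $d(\Gamma(L,G))=t+1$.
   Context: $H'(x)$ is the formal derivative of $H(x)$; the remainder $G(x)\in\mathbb F_{q^m}[x]$ is the polynomial of degree at most $t$ of the form $G(x)=U(x)H(x)+V(x)H'(x)$ with $U(x)\in\mathbb F_{q^m}[x]$. $\operatorname{Tr}_{\mathbb F_{q^{t+1}}/\mathbb F_q}(z)=\sum_{i=0}^t z^{q^i}$ is the field trace. Enumerate $L=\{\gamma_1,\ldots,\gamma_n\}$ with $n=|L|$. For a polynomial $G(x)\in\mathbb F_{q^m}[x]$ of degree at most $n$ with no zero in $L$, the $q$-ary Goppa code with support $L$ and Goppa polynomial $G$ is $$\Gamma(L,G)=\Bigl\{(c_1,\ldots,c_n)\in\mathbb F_q^n\ \Big|\ \sum_{i=1}^n\frac{c_i}{x-\gamma_i}\equiv0\pmod{G(x)}\Bigr\},$$ where $\frac1{x-\gamma_i}$ denotes the inverse of $x-\gamma_i$ modulo $G(x)$. The minimum distance $d(\mathcal C)$ of a linear code $\mathcal C$ is the minimum number of nonzero coordinates of a nonzero codeword. *)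

(* Defs.v *)
From HB Require Import structures.
From mathcomp Require Import all_boot all_order all_algebra all_field.

Set Implicit Arguments.
Unset Strict Implicit.
Unset Printing Implicit Defensive.

Import GRing.Theory.
Local Open Scope ring_scope.

(* The inverse of p modulo g. The Bezout relation of egcdp only holds up to a
   nonzero constant, which is divided out here; meaningful when p and g are
   coprime, see polyinvmodP. *)
Definition polyinvmod (K : fieldType) (g p : {poly K}) : {poly K} :=
  let e := egcdp p g in (lead_coef (e.1 * p + e.2 * g))^-1 *: e.1.

Lemma polyinvmodP (K : fieldType) (g p : {poly K}) :
  coprimep p g -> g %| p * polyinvmod g p - 1.
Proof.
move=> cpg; rewrite /polyinvmod /=.
have := egcdpE p g; set e := egcdp p g => /eqp_size.
rewrite (coprimep_size_gcd cpg) => /esym/eqP/size_poly1P[c c_neq0 Bez].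
have {}Bez : e.1 * p + e.2 * g = c%:P by [].
rewrite Bez lead_coefC -scalerAr (mulrC p) -(addrK (e.2 * g) (e.1 * p)) Bez.
rewrite scalerBr -mul_polyC -polyCM mulVf // addrAC subrr sub0r dvdpNr.
by rewrite scalerAl dvdp_mull.
Qed.

(* F plays the role of F_q, K that of F_{q^m}; the support is given as the
   duplicate-free tuple enumerating it. *)
Definition goppa_code (F : finFieldType) (K : fieldExtType F) (n : nat)
    (L : n.-tuple K) (G : {poly K}) : {set 'rV[F]_n} :=
  [set c : 'rV[F]_n |
    G %| \sum_(i < n) in_alg K (c 0 i) *: polyinvmod G ('X - (tnth L i)%:P)].

Definition hamming_weight (F : finFieldType) (n : nat) (c : 'rV[F]_n) : nat :=
  #|[set i : 'I_n | c 0 i != 0]|.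

(* A relation, because a code with no nonzero codeword has no minimum
   distance. *)
Definition is_min_distance (F : finFieldType) (n : nat)
    (C : {set 'rV[F]_n}) (d : nat) : Prop :=
  (exists c, [/\ c \in C, c != 0 & hamming_weight c = d]) /\
  (forall c, c \in C -> c != 0 -> (d <= hamming_weight c)%N).

(* The trace of E over F, on elements of E. *)
Definition ff_trace (F : finFieldType) (K : fieldExtType F)
    (E : {subfield K}) (z : K) : K :=
  \sum_(i < \dim E) z ^+ (#|F| ^ i).

(* Main.v *)
Require Import Defs.
From HB Require Import structures.
From mathcomp Require Import all_boot all_order all_algebra all_field.
From mathcomp Require Import ring.

(** By Lagrange interpolation at the conjugates [alpha_i] of [alpha], the roots
    of [H], the remainder of [V H'] modulo [H] is the sum of the
    [V(alpha_i) H(x) / (x - alpha_i)]. Its coefficient of degree [t] is the sum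
    of the [V(alpha_i)], which is the trace expression assumed nonzero. So
    [deg G = t], and clearing denominators in the defining congruence shows that
    a nonzero codeword has weight at least [t + 1]. Conversely, the divisibility
    conditions make [alpha^mu1] and [alpha^mu2] eigenvectors of the Frobenius map
    with eigenvalues in [F], so that all the [V(alpha_i)] are [F]-multiples of
    one [w]; the vector with entries [V(alpha_i) / w] at the positions of the
    [alpha_i] is then a codeword of weight [t + 1]. *)

Set Implicit Arguments.
Unset Strict Implicit.
Unset Printing Implicit Defensive.

Import GRing.Theory.
Local Open Scope ring_scope.

(** * Interpolation with unnormalised Lagrange basis polynomials *)

Section LagrangeInterpolation.

Variables (R : idomainType) (I : finType) (S : {set I}) (g : I -> R).
Hypothesis g_inj : injective g.

Let P := \prod_(j in S) ('X - (g j)%:P).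

(** This is [P / ('X - g i)], a Lagrange basis polynomial kept monic, so that top coefficients can
    be read off. *)
Definition prod_others (i : I) : {poly R} :=
  \prod_(j in S :\ i) ('X - (g j)%:P).

Lemma size_prod_setXsubC (A : {set I}) :
  size (\prod_(j in A) ('X - (g j)%:P)) = #|A|.+1.
Proof. by rewrite -big_enum /= size_prod_XsubC -cardE. Qed.

Lemma size_prod_others i : i \in S -> size (prod_others i) = #|S|.
Proof. by move=> Si; rewrite size_prod_setXsubC (cardsD1 i S) Si. Qed.

Lemma coef_prod_others i : i \in S -> (prod_others i)`_(#|S|.-1) = 1.
Proof.
move=> Si; rewrite -(size_prod_others Si) -lead_coefE.
by apply/monicP; rewrite monic_prod_XsubC.
Qed.

Lemma mul_prod_others i : i \in S -> ('X - (g i)%:P) * prod_others i = P.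
Proof. by move=> Si; rewrite /P (big_setD1 i). Qed.

Lemma prod_others_neq0 i : (prod_others i).[g i] != 0.
Proof.
rewrite horner_prod prodf_seq_neq0; apply/allP=> j _ /=; apply/implyP.
rewrite !inE !hornerE subr_eq0 => /andP[ji _].
by apply: contra ji => /eqP/g_inj->.
Qed.

Lemma prod_others_eq0 i j : j \in S -> i != j -> (prod_others i).[g j] = 0.
Proof.
move=> Sj ij; rewrite /prod_others (big_setD1 j) ?inE 1?eq_sym ?ij //=.
by rewrite !hornerE subrr mul0r.
Qed.

Lemma horner_sum_prod_others (w : I -> R) j : j \in S ->
  (\sum_(i in S) w i *: prod_others i).[g j] = w j * (prod_others j).[g j].
Proof.
move=> Sj; rewrite horner_sum (big_setD1 j) //= hornerZ big1 ?addr0 // => i.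
by rewrite !inE hornerZ => /andP[ij _]; rewrite prod_others_eq0 ?mulr0.
Qed.

Lemma size_sum_prod_others (w : I -> R) :
  (size (\sum_(i in S) w i *: prod_others i)%R <= #|S|)%N.
Proof.
apply: (leq_trans (size_sum _ _ _)); apply/bigmax_leqP => i Si.
by rewrite (leq_trans (size_scale_leq _ _)) ?size_prod_others.
Qed.

Lemma coef_sum_prod_others (w : I -> R) :
  (\sum_(i in S) w i *: prod_others i)`_(#|S|.-1) = \sum_(i in S) w i.
Proof.
rewrite coef_sum; apply: eq_bigr => i Si.
by rewrite coefZ coef_prod_others ?mulr1.
Qed.

Lemma horner_deriv_prod j : j \in S -> P^`().[g j] = (prod_others j).[g j].
Proof.
move=> Sj; rewrite -(mul_prod_others Sj) derivM derivXsubC mul1r.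
by rewrite !hornerE subrr mul0r addr0.
Qed.

Lemma lagrange_interpolation (p : {poly R}) (w : I -> R) :
    (size p <= #|S|)%N ->
    (forall i, i \in S -> p.[g i] = w i * P^`().[g i]) ->
  p = \sum_(i in S) w i *: prod_others i.
Proof.
move=> sz_p p_val; apply/eqP; rewrite -subr_eq0; apply/eqP.
set d := p - _; apply/eqP; apply/idPn => d0.
have /(max_poly_roots d0) : all (root d) [seq g i | i <- enum S].
  apply/allP=> _ /mapP[i + ->]; rewrite mem_enum => Si.
  rewrite rootE hornerD hornerN horner_sum_prod_others // p_val //.
  by rewrite horner_deriv_prod // subrr.
rewrite map_inj_uniq ?enum_uniq // size_map -cardE => /(_ isT).
apply/negP; rewrite -leqNgt (leq_trans (size_polyD _ _)) // geq_max sz_p.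
by rewrite size_polyN size_sum_prod_others.
Qed.

End LagrangeInterpolation.

(** * Goppa codewords and the lower bound on their weight *)

Section GoppaCode.

Variables (F : finFieldType) (K : fieldExtType F) (n : nat).
Variables (L : n.-tuple K) (G : {poly K}).
Hypothesis L_uniq : uniq L.
Hypothesis G_neq0 : forall x, x \in L -> G.[x] != 0.

Let L_inj : injective (tnth L).
Proof. exact/tuple_uniqP. Qed.

(* Multiplying the defining congruence by the locator polynomial of [S], which
   is a unit modulo [G], clears the inverses. *)
Lemma goppa_codeE (S : {set 'I_n}) (c : 'rV[F]_n) :
    (forall i, i \notin S -> c 0 i = 0) ->
  (c \in goppa_code L G) =
    (G %| \sum_(i in S) in_alg K (c 0 i) *: prod_others S (tnth L) i).
Proof.
move=> cS; rewrite inE.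
pose P := \prod_(j in S) ('X - (tnth L j)%:P).
have cop i : coprimep G ('X - (tnth L i)%:P).
  by rewrite coprimep_XsubC rootE G_neq0 ?mem_tnth.
have copP : coprimep G P.
  rewrite /P; elim/big_ind: _ => [|p r Hp Hr|//]; first exact: coprimep1.
  by rewrite coprimepMr Hp.
rewrite -(Gauss_dvdpr _ copP) [X in P * X](bigID (mem S)) /=.
rewrite [X in _ + X]big1 => [|i /cS->]; last by rewrite ?in_algE !scale0r.
(* The added summands are multiples of [G], since each inverse is one modulo [G]. *)
rewrite addr0 mulr_sumr -[RHS](dvdp_addr _ (m := \sum_(i in S)
  in_alg K (c 0 i) *: (prod_others S (tnth L) i *
    (('X - (tnth L i)%:P) * polyinvmod G ('X - (tnth L i)%:P) - 1)))).
  rewrite -big_split /=; congr (_ %| _); apply: eq_bigr => i Si.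
  rewrite -scalerDr -scalerAr; congr (_ *: _).
  by rewrite mulrBr mulr1 subrK mulrA (mulrC (prod_others _ _ _)) mul_prod_others.
elim/big_ind: _ => [|p r Hp Hr|i Si]; first exact: dvdp0.
  by rewrite dvdp_addr.
rewrite -mul_polyC dvdp_mull // dvdp_mull // polyinvmodP //.
by rewrite coprimep_sym.
Qed.

(** For [S] the set of nonzero positions of [c], the cleared sum is a multiple of [G] of size at
    most [#|S|]. It is nonzero because its value at a point of [S] is. *)
Lemma goppa_code_weight (c : 'rV[F]_n) :
  c \in goppa_code L G -> c != 0 -> (size G <= hamming_weight c)%N.
Proof.
move=> cC c0; set S := [set i | c 0 i != 0].
have cS i : i \notin S -> c 0 i = 0 by rewrite inE negbK => /eqP.
move: cC; rewrite (goppa_codeE cS); set s := \sum_(i in S) _ => Gs.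
have [j Sj] : exists j, j \in S.
  apply/existsP; apply: contraR c0 => /existsPn c0.
  by apply/eqP/rowP=> i; rewrite mxE cS.
have s0 : s != 0.
  apply: contraTneq (Sj) => s0; rewrite inE negbK.
  have /eqP := horner_sum_prod_others (tnth L) (fun i => in_alg K (c 0 i)) Sj.
  rewrite -/s s0 horner0 eq_sym mulf_eq0 (negPf (prod_others_neq0 _ L_inj _)).
  by rewrite orbF fmorph_eq0.
exact: leq_trans (dvdp_leq s0 Gs) (size_sum_prod_others _ _ _).
Qed.

End GoppaCode.

(** * The Frobenius map over [F] and the conjugates of a root *)

Section Frobenius.

Variables (F : finFieldType) (K : fieldExtType F).
Implicit Types (x : K) (P : {poly K}).

Definition frob x : K := x ^+ #|F|.

Fact frob_is_zmod_morphism : zmod_morphism frob.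
Proof.
move=> x y; have [p _ charFp] := finPcharP F.
rewrite /frob (card_pprimeChar charFp).
have charK : p \in [pchar K] by rewrite pchar_lalg.
elim: (logn _ _) => [|n IHn]; first by rewrite !expr1.
by rewrite expnSr !exprM IHn -!(pFrobenius_autE charK) rmorphB.
Qed.

Fact frob_is_monoid_morphism : monoid_morphism frob.
Proof. by split=> [|x y]; rewrite /frob ?expr1n ?exprMn. Qed.

HB.instance Definition _ :=
  GRing.isZmodMorphism.Build K K frob frob_is_zmod_morphism.
HB.instance Definition _ :=
  GRing.isMonoidMorphism.Build K K frob frob_is_monoid_morphism.

Lemma iter_frob k x : iter k frob x = x ^+ (#|F| ^ k).
Proof. by elim: k => //= k ->; rewrite /frob -exprM expnSr. Qed.

Lemma frob_in_alg a : frob (in_alg K a) = in_alg K a.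
Proof. by rewrite /frob -rmorphXn expf_card. Qed.

Lemma frob_fix_mem1 x : (x \in 1%VS) = (frob x == x).
Proof. by rewrite (Fermat's_little_theorem 1%AS) dimv1 expn1. Qed.

Lemma frob_fixedP x : frob x = x -> exists a, x = in_alg K a.
Proof.
by move/eqP; rewrite -frob_fix_mem1 => /vlineP[a ->]; exists a.
Qed.

Lemma map_poly_frob_fixedP P :
  map_poly frob P = P -> exists Q : {poly F}, P = map_poly (in_alg K) Q.
Proof.
move=> fP; apply/polyOver1P/polyOverP=> i.
by rewrite frob_fix_mem1 -coef_map fP.
Qed.

Lemma root_iter_frob (H : {poly F}) k x :
  root (map_poly (in_alg K) H) x ->
  root (map_poly (in_alg K) H) (iter k frob x).
Proof.
elim: k => //= k IHk /IHk.
suff fH : map_poly frob (map_poly (in_alg K) H) = map_poly (in_alg K) H.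
  by move/(rmorph_root frob); rewrite fH.
by rewrite -map_poly_comp; apply: eq_map_poly => a; apply: frob_in_alg.
Qed.

(* The product of the [d] conjugates of [x] has coefficients in [F], so it
   cannot be coprime to [H]. *)
Lemma size_irreducible_frob_period (H : {poly F}) x d :
    irreducible_poly H -> root (map_poly (in_alg K) H) x ->
    (0 < d)%N -> iter d frob x = x ->
  (size H <= d.+1)%N.
Proof.
move=> irrH Hx d_gt0 xd.
pose P := \prod_(k < d) ('X - (iter k frob x)%:P).
have [Q PQ] : exists Q : {poly F}, P = map_poly (in_alg K) Q.
  apply: map_poly_frob_fixedP; rewrite /P rmorph_prod /=.
  (* Frobenius shifts the factors by one; [xd] closes the cycle. *)
  rewrite (eq_bigr (fun k : 'I_d => 'X - (iter k.+1 frob x)%:P)); last first.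
    by move=> k _; rewrite map_polyXsubC.
  case: d d_gt0 xd @P => // d _ xd /=.
  by rewrite big_ord_recr big_ord_recl mulrC; move: xd => /= ->.
have szQ : size Q = d.+1.
  rewrite -(size_map_poly (in_alg K)) -PQ /P.
  by rewrite -(big_mkord xpredT (fun k => 'X - (iter k frob x)%:P))
    size_prod_XsubC size_iota subn0.
have Px : root P x.
  case: d d_gt0 {xd szQ PQ} @P => // d _ P; rewrite /P big_ord_recl.
  by rewrite rootM root_XsubC eqxx.
have Q0 : Q != 0 by rewrite -size_poly_gt0 szQ.
rewrite -szQ dvdp_leq //; apply: contraLR Px; rewrite -irreducible_poly_coprime //.
by rewrite -(coprimep_map (in_alg K)) -PQ => /coprimep_root; apply.
Qed.

(** A coincidence of two exponents would, by injectivity of Frobenius, give [x] a period smaller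
    than the degree of [H]. *)
Lemma uniq_conjugates (H : {poly F}) x :
    irreducible_poly H -> root (map_poly (in_alg K) H) x ->
  uniq [seq x ^+ (#|F| ^ k) | k <- iota 0 (size H).-1].
Proof.
move=> irrH Hx.
apply/(uniqP 0) => i j; rewrite !inE size_map size_iota.
wlog ij : i j / (i <= j)%N.
  by move=> IH; case: (leqP i j) => [|/ltnW] ij Hi Hj e;
     [|apply: esym]; apply: IH.
move=> Hi Hj; rewrite !(nth_map 0%N) ?size_iota // !nth_iota // !add0n.
rewrite -!iter_frob -(subnKC ij) iterD.
have iter_inj : injective (iter i frob).
  elim: i {Hi ij} => //= i IHi y z /(fmorph_inj frob); exact: IHi.
move/iter_inj/esym/(size_irreducible_frob_period irrH Hx).
move: ij; rewrite leq_eqVlt => /predU1P[->|ij]; first by rewrite subnn addn0.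
rewrite subn_gt0 ij => /(_ isT); move: Hj; case: (size H) => //= s Hj.
rewrite ltnS => sj; have := leq_trans Hj sj.
by rewrite ltnNge leq_subr.
Qed.

Lemma prod_conjugates (H : {poly F}) x :
    H \is monic -> irreducible_poly H -> root (map_poly (in_alg K) H) x ->
  map_poly (in_alg K) H =
    \prod_(z <- [seq x ^+ (#|F| ^ k) | k <- iota 0 (size H).-1]) ('X - z%:P).
Proof.
move=> monH irrH Hx; rewrite [LHS](all_roots_prod_XsubC
  (rs := [seq x ^+ (#|F| ^ k) | k <- iota 0 (size H).-1])).
- by rewrite lead_coef_map (monicP monH) rmorph1 scale1r.
- rewrite size_map_poly size_map size_iota prednK //.
  by case: irrH => /ltnW.
- by apply/allP=> _ /mapP[k _ ->]; rewrite -iter_frob root_iter_frob.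
- by rewrite uniq_rootsE uniq_conjugates.
Qed.

(* If [a ^+ (q - 1)] lies in [F], then [a] is an eigenvector of the Frobenius
   map. *)
Lemma frob_eigenvector (a : K) : a ^+ ((#|F| - 1) ^ 2) = 1 ->
  exists z : F, forall k, a ^+ (#|F| ^ k) = in_alg K (z ^+ k) * a.
Proof.
move=> a1; have q_gt0 : (0 < #|F|)%N by rewrite ltnW ?finNzRing_gt1.
have [z Dz] : exists z, a ^+ (#|F| - 1) = in_alg K z.
  (* With [q = #|F|], the [q]-th power of [a ^+ (q - 1)] is [a ^+ ((q - 1) ^ 2)] times itself. *)
  apply: frob_fixedP; rewrite /frob -[X in _ ^+ X](subnK q_gt0) exprD expr1.
  by rewrite -exprM mulnn a1 mul1r.
exists z; elim=> [|k IHk]; first by rewrite expr0 rmorph1 mul1r.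
rewrite -iter_frob /= iter_frob IHk rmorphM /= frob_in_alg.
by rewrite /frob -(subnK q_gt0) exprD expr1 Dz mulrA -rmorphM exprSr.
Qed.

End Frobenius.

(** * Positions of the conjugates in the support, and the values of [V] there *)

Lemma perm_support (T : eqType) (n : nat) (L : n.-tuple T) (rs : seq T) :
    uniq L -> uniq rs -> {subset rs <= L} ->
  perm_eq [seq tnth L i | i in [set i | tnth L i \in rs]] rs.
Proof.
move=> /tuple_uniqP L_inj rs_uniq rsL.
apply: uniq_perm; rewrite // ?map_inj_uniq ?enum_uniq // => x.
apply/imageP/idP => [[i + ->] | rs_x]; first by rewrite inE.
by have /tnthP[i Dx] := rsL x rs_x; exists i; rewrite // inE -Dx.
Qed.

(* [l3] is an [F]-multiple of [l2 * alpha ^+ mu2], while [alpha ^+ mu1] and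
   [alpha ^+ mu2] are Frobenius eigenvectors. *)
Lemma horner_conjugates_proportional (F : finFieldType) (K : fieldExtType F)
    (alpha l1 l2 l3 : K) (mu1 mu2 t : nat) (c : F) :
    alpha != 0 -> l2 != 0 ->
    (alpha ^+ mu1) ^+ ((#|F| - 1) ^ 2) = 1 ->
    (alpha ^+ mu2) ^+ ((#|F| - 1) ^ 2) = 1 ->
    1 + l3 / (l2 * alpha ^+ (mu2 * #|F| ^ t)) = in_alg K c ->
  exists e : nat -> F, forall k,
    ((l1 *: 'X^mu1) * (l2 *: 'X^mu2 + l3%:P)).[alpha ^+ (#|F| ^ k)]
      = l1 * alpha ^+ mu1 * (l2 * alpha ^+ mu2) * in_alg K (e k).
Proof.
move=> alpha0 l20 /frob_eigenvector[z1 Dz1] /frob_eigenvector[z2 Dz2] Dc.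
exists (fun k => z1 ^+ k * (z2 ^+ k + (c - 1) * z2 ^+ t)) => k.
(* Solve the hypothesis on [c] for [l3], using that [alpha ^+ (mu2 * #|F| ^ t)] is [z2 ^+ t] times
   [alpha ^+ mu2]. *)
have Dl3 : l3 = l2 * alpha ^+ mu2 * in_alg K ((c - 1) * z2 ^+ t).
  have Dc1 : in_alg K (c - 1) = l3 / (l2 * alpha ^+ (mu2 * #|F| ^ t)).
    apply: (addrI 1); rewrite Dc -[X in X + _](rmorph1 (in_alg K)).
    by rewrite -rmorphD addrC subrK.
  have : in_alg K (z2 ^+ t) * alpha ^+ mu2 != 0 by rewrite -Dz2 !expf_neq0.
  rewrite mulf_eq0 negb_or => /andP[z20 a20].
  rewrite rmorphM /= -!in_algE Dc1 exprM Dz2.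
  by set z := in_alg K _ in z20 *; field; rewrite l20 z20 a20.
rewrite hornerM hornerD !hornerZ hornerC !hornerXn.
rewrite [_ ^+ mu1]exprAC [_ ^+ mu2]exprAC Dz1 Dz2 [in LHS]Dl3 !(rmorphM, rmorphD).
ring.
Qed.

Theorem mainTheorem5
  (q m t : nat)
  (F : finFieldType) (hq : #|F| = q)
  (K : fieldExtType F) (hm : \dim {:K} = m) (hm1 : (1 <= m)%N)
  (htm : (t.+1 %| m)%N)
  (E : {subfield K}) (hE : \dim E = t.+1)
  (H : {poly F}) (hHmonic : H \is monic) (hHirr : irreducible_poly H)
  (hHdeg : size H = t.+2)
  (alpha : K) (halphaE : alpha \in E) (halpha0 : alpha != 0)
  (halphaH : root (map_poly (in_alg K) H) alpha)
  (n : nat) (L : n.-tuple K) (hLuniq : uniq L)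
  (hLalpha : forall i : nat, (1 <= i <= t.+1)%N -> alpha ^+ (q ^ i.-1) \in L)
  (lambda1 lambda2 lambda3 : K)
  (hl1 : lambda1 != 0) (hl2 : lambda2 != 0) (hl3 : lambda3 != 0)
  (mu1 mu2 : nat) (hmu1 : (0 < mu1)%N) (hmu2 : (0 < mu2)%N)
  (V1 V2 V : {poly K})
  (hV1 : V1 = lambda1 *: 'X^mu1)
  (hV2 : V2 = lambda2 *: 'X^mu2 + lambda3%:P)
  (hV : V = V1 * V2)
  (G : {poly K})
  (hG : G = (V * map_poly (in_alg K) H^`()) %% map_poly (in_alg K) H)
  (hGL : forall eta : K, eta \in L -> G.[eta] != 0)
  (Nalpha : nat) (hN : Nalpha.-primitive_root alpha)
  (hTr : lambda1 * lambda2 * ff_trace E (alpha ^+ (mu1 + mu2))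
         + lambda1 * lambda3 * ff_trace E (alpha ^+ mu1) != 0)
  (hdvd1 : (Nalpha %/ gcdn Nalpha ((q - 1) ^ 2) %| mu1)%N)
  (hdvd2 : (Nalpha %/ gcdn Nalpha ((q - 1) ^ 2) %| mu2)%N)
  (hFq : exists2 c : F, c != 0 &
         1 + lambda3 / (lambda2 * alpha ^+ (mu2 * q ^ t)) = in_alg K c)
  (hl3ne : forall i : nat, (1 <= i <= t)%N ->
           lambda3 != - (lambda2 * alpha ^+ (mu2 * q ^ i.-1))) :
  is_min_distance (goppa_code L G) t.+1.
Proof.
subst q; set rs := [seq alpha ^+ (#|F| ^ k) | k <- iota 0 (size H).-1].
have rs_uniq : uniq rs := uniq_conjugates hHirr halphaH.
have sz_rs : size rs = t.+1 by rewrite size_map size_iota hHdeg.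
have HE : map_poly (in_alg K) H = \prod_(z <- rs) ('X - z%:P).
  exact: prod_conjugates.
have rsL : {subset rs <= L}.
  move=> _ /mapP[k + ->]; rewrite mem_iota hHdeg => /andP[_ kt].
  exact: (hLalpha k.+1).
have perm_S := perm_support hLuniq rs_uniq rsL.
set S := [set i | tnth L i \in rs] in perm_S.
have cardS : #|S| = t.+1 by rewrite -sz_rs -(perm_size perm_S) size_map -cardE.
have L_inj : injective (tnth L) by apply/tuple_uniqP.
have HS : map_poly (in_alg K) H = \prod_(j in S) ('X - (tnth L j)%:P).
  by rewrite HE -(perm_big _ perm_S) big_image.
have H0 : map_poly (in_alg K) H != 0 by rewrite -size_poly_gt0 size_map_poly hHdeg.
(* [G] agrees with [V * H'] at the roots of [H], so the interpolation weights are the values of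
   [V]. *)
have GE : G = \sum_(i in S) V.[tnth L i] *: prod_others S (tnth L) i.
  apply: lagrange_interpolation => // [|i Si].
    by rewrite cardS hG -ltnS -[X in (_ < X)%N]hHdeg -(size_map_poly (in_alg K))
      ltn_modp.
  have Hi : (map_poly (in_alg K) H).[tnth L i] = 0.
    apply/eqP; rewrite -/(root _ _) HE root_prod_XsubC.
    by move: Si; rewrite inE.
  rewrite -HS deriv_map -hornerM.
  by rewrite [in RHS](divp_eq (V * _) (map_poly (in_alg K) H)) -hG !hornerE Hi
    mulr0 add0r.
have VE x : V.[x] = lambda1 * lambda2 * x ^+ (mu1 + mu2)
                    + lambda1 * lambda3 * x ^+ mu1.
  by rewrite hV hV1 hV2 !hornerE /= exprD; ring.
have szG : size G = t.+1.
  apply/eqP; rewrite eqn_leq; apply/andP; split.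
    by rewrite GE -cardS size_sum_prod_others.
  (* A smaller size would kill the coefficient of degree [t], which is the trace expression. *)
  rewrite ltnNge; apply: contra hTr => /leq_sizeP/(_ t (leqnn t)) Gt.
  rewrite -[X in _ == X]Gt GE -[X in _`_X]/(t.+1.-1) -cardS coef_sum_prod_others.
  have -> : \sum_(i in S) V.[tnth L i] = \sum_(z <- rs) V.[z].
    by rewrite -(perm_big _ perm_S) big_image.
  rewrite big_map hHdeg -[iota _ _]/(index_iota 0 t.+1) big_mkord /ff_trace hE.
  rewrite !mulr_sumr -big_split /=; apply/eqP/eq_bigr => k _.
  by rewrite VE -!exprM ![(_ ^ k * _)%N]mulnC.
have alpha1 mu : (Nalpha %/ gcdn Nalpha ((#|F| - 1) ^ 2) %| mu)%N ->
    (alpha ^+ mu) ^+ ((#|F| - 1) ^ 2) = 1.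
  move=> dv; rewrite -exprM; apply/eqP; rewrite -(prim_order_dvd hN).
  (* Split [Nalpha] as its cofactor, dividing [mu], times the gcd, dividing [(#|F| - 1) ^ 2]. *)
  by rewrite -{1}(divnK (dvdn_gcdl Nalpha ((#|F| - 1) ^ 2))) dvdn_mul ?dvdn_gcdr.
case: hFq => c _ Dc.
have [e De] := horner_conjugates_proportional lambda1 halpha0 hl2
  (alpha1 _ hdvd1) (alpha1 _ hdvd2) Dc.
set w := lambda1 * _ * _ in De.
have w0 : w != 0 by rewrite !mulf_neq0 ?expf_neq0.
(* The index in [rs] recovers the Frobenius exponent of the conjugate. *)
pose cw : 'rV[F]_n := \row_i if i \in S then e (index (tnth L i) rs) else 0.
have cwE i : i \in S -> in_alg K (cw 0 i) = w^-1 * V.[tnth L i].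
  move=> Si; rewrite mxE Si; move: Si; rewrite inE => rs_i.
  apply: (canRL (mulKf w0)).
  rewrite hV hV1 hV2 -De; congr (_.[_]).
  have := rs_i; rewrite -index_mem size_map size_iota => lt_i.
  by rewrite -[RHS](nth_index 0 rs_i) (nth_map 0%N) ?size_iota ?nth_iota.
have cw_out i : i \notin S -> cw 0 i = 0 by rewrite mxE => /negPf->.
have cw_neq0 i : (cw 0 i != 0) = (i \in S).
  have [Si|/cw_out->] := boolP (i \in S); last by rewrite eqxx.
  rewrite -(fmorph_eq0 (in_alg K)) -[X in X == _]/(in_alg K (cw 0 i)) cwE //.
  rewrite mulf_neq0 ?invr_eq0 //.
  (* [V] cannot vanish at a conjugate, since its value there divides that of [G]. *)
  have := hGL _ (mem_tnth i L); rewrite GE horner_sum_prod_others //.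
  by apply: contraNneq => ->; rewrite mul0r.
have cw_weight : hamming_weight cw = t.+1.
  by rewrite -cardS /hamming_weight; apply: eq_card => i; rewrite inE cw_neq0.
split; last first.
  by move=> d dC d0; rewrite -szG; apply: (goppa_code_weight hLuniq hGL).
exists cw; split=> //; last first.
  apply: contra_eq_neq cw_weight => ->.
  by rewrite /hamming_weight eq_card0 // => i; rewrite !inE mxE eqxx.
rewrite (goppa_codeE hGL cw_out).
(* The cleared sum of [cw] is exactly [w^-1 *: G]. *)
rewrite (eq_bigr (fun i => w^-1 *: (V.[tnth L i] *: prod_others S (tnth L) i))).
  by rewrite -scaler_sumr -GE -mul_polyC dvdp_mull.
by move=> i Si; rewrite scalerA -(cwE _ Si).
Qed.
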